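(* Let $q$ be a prime power, $h\ge 1$, $k>3$, and let $C$ be an $\mathbb F_q$-linear $(n,q^{hk},n-k+1)_{q^h}$ MDS code over $\mathbb F_{q^h}$. Suppose there exist two subsets $A,B\subset[1,n]$ with $A\cap B=\varnothing$ and $|A|+|B|\le k-2$ such that the projections of $C$ from $A$ and from $B$ are $\mathbb F_q$-equivalent to linear codes. If $n>|A\cup B|+n_q(k-|A\cup B|)$, then $C$ is $\mathbb F_q$-equivalent to an $\mathbb F_{q^s}$-linear code for some divisor $s>1$ of $h$. In particular, if $n>|A\cup B|+n_{q^e}(k-|A\cup B|)$, where $e$ is the largest divisor of $h$ smaller than $h$, then $C$ is $\mathbb F_q$-equivalent to a linear code.
   Context: $n_q(k)$ denotes the maximum length of a $k$-dimensional linear MDS code over $\mathbb F_q$. A code over $\mathbb F_{q^h}$ of length $n$ is a subset of $\mathbb F_{q^h}^n$; an $(n,M,d)_{q^h}$ code has $M$ codewords and minimum Hamming distance $d$; it is MDS if $M=q^{h(n-d+1)}$. It is $\mathbb F_{q^s}$-linear if it is an $\mathbb F_{q^s}$-subspace of $\mathbb F_{q^h}^n$, and linear if it is $\mathbb F_{q^h}$-linear. Two $\mathbb F_q$-linear codes are $\mathbb F_q$-equivalent if one is obtained from the other by permuting coordinates and applying in each coordinate an $\mathbb F_q$-linear bijection of $\mathbb F_{q^h}$. The projection of $C$ from position $i$ is $\{(x_1,\dots,x_{i-1},x_{i+1},\dots,x_n):(x_1,\dots,x_{i-1},0,x_{i+1},\dots,x_n)\in C\}$; the projection from a set of positions is obtained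 by projecting consecutively from each of its positions. *)

(* Defs.v *)
From HB Require Import structures.
From mathcomp Require Import all_boot all_algebra.
Set Implicit Arguments. Unset Strict Implicit. Unset Printing Implicit Defensive.
Import GRing.Theory.
Local Open Scope ring_scope.

Definition code (I : finType) (L : finFieldType) := {set {ffun I -> L}}.

(* The subfield F_r = {a | a^r = a} of L (for r = q^s this is F_{q^s}). *)
Definition Fsub (L : finFieldType) (r : nat) : pred L := fun a => a ^+ r == a.

Definition wadd (I : finType) (L : finFieldType) (x y : {ffun I -> L}) :
  {ffun I -> L} := [ffun i => x i + y i].
Definition wscale (I : finType) (L : finFieldType) (a : L) (x : {ffun I -> L}) :
  {ffun I -> L} := [ffun i => a * x i].

Definition Fsub_linear (I : finType) (L : finFieldType) (r : nat) (C : code I L) :=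
  [ffun=> 0] \in C /\
  (forall x y, x \in C -> y \in C -> wadd x y \in C) /\
  (forall a x, Fsub r a -> x \in C -> wscale a x \in C).

Definition linear_code (I : finType) (L : finFieldType) (C : code I L) :=
  [ffun=> 0] \in C /\
  (forall x y, x \in C -> y \in C -> wadd x y \in C) /\
  (forall a x, x \in C -> wscale a x \in C).

Definition hdist (I : finType) (L : finFieldType) (x y : {ffun I -> L}) : nat :=
  #|[set i | x i != y i]|.
Definition min_dist (I : finType) (L : finFieldType) (C : code I L) (d : nat) :=
  (exists x y, [/\ x \in C, y \in C, x != y & hdist x y = d]) /\
  (forall x y, x \in C -> y \in C -> x != y -> (d <= hdist x y)%N).

Definition Fsub_lin_map (L : finFieldType) (r : nat) (f : L -> L) :=
  (forall u v, f (u + v) = f u + f v) /\ (forall a u, Fsub r a -> f (a * u) = a * f u).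

Definition Fsub_equiv (I J : finType) (L : finFieldType) (r : nat)
  (C : code I L) (D : code J L) :=
  exists (sigma : I -> J) (phi : I -> L -> L),
    [/\ bijective sigma,
        (forall i, Fsub_lin_map r (phi i) /\ bijective (phi i)) &
        (forall y, y \in D <-> exists2 x, x \in C & forall i, y (sigma i) = phi i (x i))].

(* projection from a set of positions A: keep the codewords vanishing on A
   and delete the coordinates in A (same as projecting consecutively). *)
Definition proj (I : finType) (L : finFieldType) (C : code I L) (A : {set I}) :
  code {i : I | i \notin A} L :=
  [set [ffun j : {i : I | i \notin A} => (x : {ffun I -> L}) (val j)]
     | x in C & [forall i in A, (x : {ffun I -> L}) i == 0]].

Definition linear_MDS_exists (K : finFieldType) (m k : nat) :=
  exists C : code 'I_m K, [/\ linear_code C, #|C| = (#|K| ^ k)%N & min_dist C (m - k + 1)].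

Definition is_nmax (K : finFieldType) (k N : nat) :=
  linear_MDS_exists K N k /\ (forall m, linear_MDS_exists K m k -> (m <= N)%N).

(* Main.v *)
Require Import Defs.
From HB Require Import structures.
From mathcomp Require Import all_boot all_algebra.
From mathcomp Require Import cyclic finfield zify ring.
From Stdlib Require Import Classical_Prop.
Set Implicit Arguments. Unset Strict Implicit. Unset Printing Implicit Defensive.
Import GRing.Theory.
Local Open Scope ring_scope.

(** Write [C_T] for the codewords vanishing on [T]. Linearity of the projection from [A]
    means that [L] acts on [C_A] coordinatewise, by conjugates [phi_i^-1 l phi_i] of
    multiplications, and likewise on [C_B] by [psi_i^-1 l psi_i]. Both actions live on
    [C_(A u B)], a linear MDS code of dimension [k' = k - |A u B| >= 2]. Comparing them on
    codewords of minimum weight shows that all the maps [chi_i = psi_i phi_i^-1] agree up to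
    scalars with one of them, [chi_0], and that after rescaling the coordinates the code has
    a generator matrix over the subfield [Z] of those [x] for which [chi_0] turns
    multiplication by [x] into multiplication by some [x']. Hence an MDS code of length
    [n - |A u B|] and dimension [k'] exists over [Z], which bounds [|Z|] from below. The map
    [x |-> x'] is a power of Frobenius on [Z], so after twisting [psi] by Frobenius the two
    actions of [Z] agree on [C_(A u B)]; since [C = C_A + C_B], they glue to a coordinatewise
    action of [Z] on [C].

    For the last claim, if [|Z| = q^s] with [s < e] then [s] need not divide [e]; instead
    [n - |A u B| <= |Z| + k' - 1 < 2 |Z| <= q^e] contradicts the Reed-Solomon lower bound
    for [n_(q^e)(k')] if [k' < |Z|], and [n - |A u B| <= k' + 1] if [k' >= |Z|]. *)

(** * Finite fields *)

Section LinMap.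
Variables (L : finFieldType) (r : nat).
Implicit Types f g : L -> L.

Lemma lin_map0 f : Fsub_lin_map r f -> f 0 = 0.
Proof. by case=> fD _; apply: (addrI (f 0)); rewrite -fD !addr0. Qed.

Lemma lin_mapB f : Fsub_lin_map r f -> forall x y, f (x - y) = f x - f y.
Proof.
move=> lf x y; have [fD _] := lf; rewrite fD; congr (_ + _).
by apply: (addrI (f y)); rewrite -fD !subrr (lin_map0 lf).
Qed.

Lemma lin_map_can f g : cancel f g -> cancel g f -> Fsub_lin_map r f -> Fsub_lin_map r g.
Proof.
move=> fK gK [fD fZ]; split=> [u v|a u ra]; apply: (can_inj fK).
  by rewrite fD !gK.
by rewrite fZ // !gK.
Qed.

Lemma lin_map_comp f g : Fsub_lin_map r f -> Fsub_lin_map r g -> Fsub_lin_map r (f \o g).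
Proof.
by move=> [fD fZ] [gD gZ]; split=> [u v|a u ra] /=; rewrite ?gD ?fD ?gZ ?fZ.
Qed.

End LinMap.

Section SubfieldType.
Variables (L : finFieldType) (Z : {pred L}).
Hypothesis Zdiv : divring_closed Z.
HB.instance Definition _ := GRing.isDivringClosed.Build L Z Zdiv.
Record subfield_of := Subfield {subfield_val : L; _ : subfield_val \in Z}.
HB.instance Definition _ := [isSub for subfield_val].
HB.instance Definition _ := [Finite of subfield_of by <:].
HB.instance Definition _ := [SubChoice_isSubIntegralDomain of subfield_of by <:].
HB.instance Definition _ := [SubIntegralDomain_isSubField of subfield_of by <:].

(** Makes a subfield given as a predicate into a finite field of its own, which can be the alphabet
    of a code. *)
Lemma subfield_type : exists (K : finFieldType) (iota : {rmorphism K -> L}),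
  forall x, x \in Z <-> exists y, iota y = x.
Proof.
exists subfield_of, (\val : {rmorphism subfield_of -> L}).
move=> x; split=> [Zx|[y <-]]; last exact: valP.
by exists (Subfield Zx).
Qed.
End SubfieldType.

(** With [t = m * u + r] and [r < m], [a ^ t] is [a ^ r] modulo [a ^ m - 1], and [a ^ r - 1] is too
    small to be a nonzero multiple. *)
Lemma dvdn_predX_dvd a m t : (1 < a)%N -> (0 < m)%N ->
  ((a ^ m).-1 %| (a ^ t).-1)%N -> (m %| t)%N.
Proof.
move=> a1 m0; rewrite /dvdn => /eqP H.
have e1 u : (0 < a ^ u)%N by rewrite expn_gt0; lia.
have D : ((a ^ m).-1 %| (a ^ (t %/ m * m)).-1)%N.
  by rewrite mulnC expnM dvdn_pred_predX.
have E : ((a ^ (t %/ m * m + t %% m)).-1 =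
   (a ^ (t %/ m * m)).-1 * a ^ (t %% m) + (a ^ (t %% m)).-1)%N.
  by rewrite expnD -[X in (X * _).-1](prednK (e1 _)); move: (e1 (t %% m)%N); nia.
have lt : (a ^ (t %% m) < a ^ m)%N by rewrite ltn_exp2l // ltn_mod.
move: H; rewrite [X in (a ^ X).-1](divn_eq t m) E -modnDml -modnMml.
move/eqP: D => ->; rewrite mul0n mod0n add0n modn_small; last by have := e1 (t %% m)%N; lia.
case: (t %% m)%N => // r; rewrite expnS => H.
by have := e1 r; move: H a1; nia.
Qed.

Lemma expf_predn_card (F : finFieldType) (x : F) : x != 0 -> x ^+ #|F|.-1 = 1.
Proof.
move=> x0; apply: (mulfI x0).
by rewrite -exprS mulr1 prednK ?expf_card // (ltnW (finNzRing_gt1 F)).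
Qed.

Lemma finField_prim_root (F : finFieldType) :
  exists z : F, (#|F|.-1).-primitive_root z.
Proof.
have F1 : (1 < #|F|)%N := finNzRing_gt1 F.
have /hasP[z _ zP] : has (#|F|.-1).-primitive_root (enum (predC1 (0 : F))); last by exists z.
apply: has_prim_root; rewrite ?enum_uniq //; first by lia.
  apply/allP=> x; rewrite mem_enum inE unity_rootE => x0.
  exact/eqP/expf_predn_card.
by rewrite -cardE cardC1.
Qed.

Section Frobenius.
Variables (L : finFieldType) (p m : nat).
Hypothesis Lp : p \in [pchar L].
Definition frob (x : L) := x ^+ (p ^ m).
Fact frob_additive : zmod_morphism frob.
Proof.
have N : [pchar L].-nat (p ^ m)%N by rewrite pnatX pnatE ?Lp ?(pcharf_prime Lp).
by move=> x y; rewrite /frob exprDn_pchar // exprNn_pchar.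
Qed.
Fact frob_multiplicative : monoid_morphism frob.
Proof. by split=> [|x y]; rewrite /frob ?exprMn ?expr1n. Qed.
HB.instance Definition _ := GRing.isZmodMorphism.Build L L frob frob_additive.
HB.instance Definition _ := GRing.isMonoidMorphism.Build L L frob frob_multiplicative.

(* The orbit polynomial of [theta] under [x |-> x ^+ q] has coefficients fixed by it. *)
Lemma frob_conj (chi : L -> L) (theta theta' : L) s : (0 < s)%N ->
  Fsub_lin_map (p ^ m) chi -> chi 1 != 0 ->
  theta ^+ ((p ^ m) ^ s) = theta ->
  (forall y, chi (theta * y) = theta' * chi y) ->
  exists j, theta' = theta ^+ ((p ^ m) ^ j).
Proof.
set q := (p ^ m)%N => s0 chiL chi1 thq chith; have [chiD chiZ] := chiL.
pose P : {poly L} := \prod_(j < s) ('X - (theta ^+ (q ^ j))%:P).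
have PF : map_poly frob P = P.
  rewrite /P rmorph_prod /=.
  under eq_bigr => j _ do rewrite rmorphB /= map_polyX map_polyC /= /frob -/q -exprM -expnSr.
  case: s s0 thq @P => // s _ thq _.
  by rewrite big_ord_recr big_ord_recl /= thq expn0 expr1 mulrC.
have Pc i : Fsub q P`_i.
  by apply/eqP; rewrite -{2}PF coef_map.
have chi0 := lin_map0 chiL.
have chiX i y : chi (theta ^+ i * y) = theta' ^+ i * chi y.
  by elim: i y => [|i IH] y; rewrite ?expr0 ?mul1r // !exprSr -!mulrA IH chith.
(* Coefficients pass through [chi] by linearity and powers of [theta] become powers of [theta'], so
   [P.[theta] = 0] forces [theta'] to be a root of [P]. *)
have : chi P.[theta] = P.[theta'] * chi 1.
  rewrite !horner_coef mulr_suml.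
  rewrite (big_morph chi chiD chi0); apply: eq_bigr => i _.
  by rewrite chiZ // -[theta ^+ i]mulr1 chiX mulrA.
have -> : P.[theta] = 0.
  by rewrite horner_prod (bigD1 (Ordinal s0)) //= hornerXsubC expr1 subrr mul0r.
rewrite chi0 => /esym/eqP; rewrite mulf_eq0 (negPf chi1) orbF.
rewrite horner_prod => /prodf_eq0[j _]; rewrite hornerXsubC subr_eq0 => /eqP ->.
by exists j.
Qed.
End Frobenius.

Lemma frob_lin_map (L : finFieldType) p m j : p \in [pchar L] ->
  Fsub_lin_map (p ^ m) (fun x : L => x ^+ ((p ^ m) ^ j)).
Proof.
move=> Lp; split=> [u v|a u /eqP aq].
  by rewrite exprDn_pchar // -expnM pnatX pnatE ?Lp ?(pcharf_prime Lp).
rewrite exprMn; congr (_ * _).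
by elim: j => [|j IH]; rewrite ?expr1 // expnSr exprM IH.
Qed.

(* Units of finite fields are cyclic, so the tower [F_q <= Z <= L] is read off from
   the divisibilities [q - 1 | |Z| - 1 | q^h - 1]. *)
Lemma card_subfield (L K : finFieldType) (iota : {rmorphism K -> L}) (p m h : nat) :
  prime p -> (0 < m)%N -> #|L| = ((p ^ m) ^ h)%N ->
  (forall a, Fsub (p ^ m) a -> exists y, iota y = a) ->
  exists2 s, (0 < s)%N && (s %| h)%N & #|K| = ((p ^ m) ^ s)%N.
Proof.
move=> pp m0 cL Fq; have p1 := prime_gt1 pp.
have q1 : (1 < p ^ m)%N by rewrite -{1}(exp1n m) ltn_exp2r.
have Lp : p \in [pchar L] by apply: (card_finPcharP (n := (m * h)%N)); rewrite // expnM.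
have Kp : p \in [pchar K] by move: Lp; rewrite (fmorph_pchar iota).
have [t cK] : exists t, #|K| = (p ^ t)%N.
  by eexists; exact: (card_pprimeChar Kp).
have [g gP] := finField_prim_root L; have [z zP] := finField_prim_root K.
have K1 : (1 < #|K|)%N := finNzRing_gt1 K.
have qL : ((p ^ m).-1 %| #|L|.-1)%N by rewrite cL dvdn_pred_predX.
(* [w] has order [p ^ m - 1], so it is fixed by the [p ^ m]-th power and lies in the image of
   [iota]; hence its order divides [#|K| - 1]. *)
have wP := dvdn_prim_root gP qL; set w := (g ^+ _) in wP.
have [w' w'E] : exists y, iota y = w.
  apply: Fq; apply/eqP; rewrite -[X in w ^+ X](prednK (ltnW q1)) exprS.
  by rewrite (prim_expr_order wP) mulr1.
have mt : (m %| t)%N.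
  apply: (dvdn_predX_dvd p1 m0); rewrite -cK (prim_order_dvd wP) -w'E -rmorphXn.
  rewrite expf_predn_card ?rmorph1 // -(fmorph_eq0 iota) w'E.
  by rewrite (prim_root_eq0 wP) -lt0n (prim_order_gt0 wP).
move: cK; rewrite -(divnK mt) mulnC expnM => cK; exists (t %/ m)%N => //.
have s0 : (0 < t %/ m)%N by case: (t %/ m)%N cK K1 => // ->.
rewrite s0 /=; apply: (dvdn_predX_dvd q1 s0); rewrite -cK -cL.
rewrite (prim_order_dvd zP) -(inj_eq (fmorph_inj iota)) rmorphXn rmorph1.
rewrite expf_predn_card // fmorph_eq0 (prim_root_eq0 zP) -lt0n.
exact: prim_order_gt0 zP.
Qed.

(** * MDS codes through information sets *)

Definition determined_by (I : finType) (L : finFieldType) (C : code I L) (S : {set I}) :=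
  forall x y, x \in C -> y \in C -> (forall i, i \in S -> x i = y i) -> x = y.

Definition interpolates (I : finType) (L : finFieldType) (C : code I L) (S : {set I}) :=
  forall f : I -> L, exists2 c, c \in C & forall i, i \in S -> c i = f i.

(** The minimum distance is replaced by its combinatorial form: any [k] coordinates are an
    information set. *)
Definition mds (I : finType) (L : finFieldType) (C : code I L) (k : nat) :=
  forall S : {set I}, #|S| = k -> determined_by C S /\ interpolates C S.

Section MDS.
Variables (I : finType) (L : finFieldType) (C : code I L).

Definition restr (S : {set I}) (x : {ffun I -> L}) : {ffun {i | i \in S} -> L} :=
  [ffun j => x (val j)].

Lemma restr_inj (S : {set I}) : determined_by C S -> {in C &, injective (restr S)}.
Proof.
move=> dC x y xC yC /ffunP e; apply: dC => // i iS.
by have := e (exist _ i iS); rewrite !ffunE.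
Qed.

Lemma card_restr (S : {set I}) : #|{: {ffun {i | i \in S} -> L}}| = (#|L| ^ #|S|)%N.
Proof. by rewrite card_ffun card_sig. Qed.

Lemma interpolates_card (S : {set I}) :
  determined_by C S -> #|C| = (#|L| ^ #|S|)%N -> interpolates C S.
Proof.
move=> dC cC f.
have : [set: {ffun {i | i \in S} -> L}] == restr S @: C.
  rewrite eq_sym eqEcard subsetT cardsT card_restr -cC.
  by rewrite (card_in_imset (restr_inj dC)) /= leqnn.
move/eqP/setP/(_ (restr S (finfun f))); rewrite inE => /esym/imsetP[c cC' e].
exists c => // i iS; move/ffunP/(_ (exist _ i iS)): e.
by rewrite !ffunE /= => <-.
Qed.

Lemma card_interpolates (S : {set I}) :
  determined_by C S -> interpolates C S -> #|C| = (#|L| ^ #|S|)%N.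
Proof.
move=> dC iC; rewrite -card_restr -cardsT -(card_in_imset (restr_inj dC)).
congr #|pred_of_set _|; apply/setP=> g; rewrite inE; apply/imsetP.
have [c cC e] := iC (fun i => oapp g 0 (insub i)).
exists c => //; apply/ffunP=> j; rewrite ffunE e ?valK //.
exact: valP j.
Qed.

Lemma mds_determined k : (forall S : {set I}, #|S| = k -> determined_by C S) ->
  #|C| = (#|L| ^ k)%N -> mds C k.
Proof.
move=> H cC S cS; split; first exact: H.
by apply: interpolates_card; rewrite ?cS //; apply: H.
Qed.

Lemma card_eq_le k : #|C| = (#|L| ^ k)%N -> (k <= #|I|)%N.
Proof.
move=> cC; rewrite -(@leq_exp2l #|L|) ?(finNzRing_gt1 L) // -cC -card_ffun.
exact: max_card.
Qed.

Lemma hdist_agree (S : {set I}) (x y : {ffun I -> L}) :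
  (forall i, i \in S -> x i = y i) -> (hdist x y <= #|I| - #|S|)%N.
Proof.
move=> e; rewrite -(setCK S) -cardsCs; apply: subset_leq_card; apply/subsetP=> i.
by rewrite !inE; apply: contra => iS; apply/eqP/e.
Qed.

(** Words that agree on [k] coordinates differ in at most [#|I| - k] others, one less than the
    minimum distance. *)
Lemma min_dist_mds k :
  #|C| = (#|L| ^ k)%N -> min_dist C (#|I| - k + 1) -> mds C k.
Proof.
move=> cC [_ d]; apply: mds_determined => // S cS x y xC yC e.
apply/eqP/contraT => xy; have := d x y xC yC xy; have := hdist_agree e.
by rewrite cS; lia.
Qed.

Lemma set_between (T : {set I}) k : (#|T| <= k <= #|I|)%N ->
  exists2 S : {set I}, T \subset S & #|S| = k.
Proof.
case/andP=> Tk kI; have : (k - #|T| <= #|~: T|)%N by rewrite (cardsCs (~: T)) setCK; lia.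
case/card_geqP=> s [us ss sT]; exists (T :|: [set x in s]); first exact: subsetUl.
rewrite cardsU (_ : T :&: _ = set0); last first.
  apply/setP=> x; rewrite !inE; apply/andP=> -[xT xs].
  by have := sT x xs; rewrite inE xT.
by rewrite cards0 cardsE (card_uniqP us) ss; lia.
Qed.

Lemma mds_min_dist k : (0 < k <= #|I|)%N ->
  [ffun=> 0] \in C -> mds C k -> min_dist C (#|I| - k + 1).
Proof.
case/andP=> k0 kI C0 mC; have lb x y : x \in C -> y \in C -> x != y ->
    (#|I| - k + 1 <= hdist x y)%N.
  move=> xC yC; apply: contraNT; rewrite -ltnNge => lt.
  have : (k <= #|[set i | x i == y i]|)%N.
    rewrite cardsCs (_ : ~: _ = [set i | x i != y i]).
      rewrite -/(hdist x y); move: lt kI; lia.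
    by apply/setP=> i; rewrite !inE.
  case/card_geqP=> s [us ss sT].
  apply/eqP/(proj1 (mC [set i in s] _)) => //.
    by rewrite cardsE (card_uniqP us).
  by move=> i; rewrite inE => /sT; rewrite inE => /eqP.
split=> //.
have [S _ cS] : exists2 S : {set I}, set0 \subset S & #|S| = k.
  by apply: set_between; rewrite cards0.
have /card_gt0P[j jS] : (0 < #|S|)%N by rewrite cS.
(* A codeword that is [1] at [j] and [0] on the rest of [S] attains the bound: it agrees with zero
   on [k - 1] positions. *)
have [c cC e] := proj2 (mC S cS) (fun i => (i == j)%:R).
have c0 : c != [ffun=> 0].
  apply/eqP=> /ffunP/(_ j); rewrite ffunE e // eqxx; exact/eqP/oner_neq0.
exists c, [ffun=> 0]; split=> //; apply/eqP; rewrite eqn_leq lb // andbT.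
have -> : (#|I| - k + 1 = #|I| - #|S :\ j|)%N.
  by have := cardsD1 j S; rewrite jS cS; lia.
by apply: hdist_agree => i; rewrite !inE => /andP[ij iS]; rewrite e // ffunE (negPf ij).
Qed.

End MDS.

(** Transfers a code on any finite index type to an ordinal one, and trades the minimum distance for
    information sets. *)
Lemma linear_MDS_exists_mds (I : finType) (K : finFieldType) (C : code I K) k :
  (0 < k)%N -> linear_code C -> #|C| = (#|K| ^ k)%N ->
  (forall S : {set I}, #|S| = k -> determined_by C S) ->
  linear_MDS_exists K #|I| k.
Proof.
move=> k0 [C0 [CD CZ]] cC dC; have kI := card_eq_le cC.
pose f (x : {ffun I -> K}) : {ffun 'I_#|I| -> K} := [ffun i => x (enum_val i)].
have finj : injective f.
  move=> x y /ffunP e; apply/ffunP=> i.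
  by have := e (enum_rank i); rewrite !ffunE enum_rankK.
have cD : #|f @: C| = (#|K| ^ k)%N by rewrite card_imset.
have D0 : [ffun=> 0] \in f @: C.
  by apply/imsetP; exists [ffun=> 0] => //; apply/ffunP=> i; rewrite !ffunE.
exists (f @: C); split=> //.
  split=> //; split=> [_ _ /imsetP[x xC ->] /imsetP[y yC ->]|a _ /imsetP[x xC ->]].
    apply/imsetP; exists (wadd x y); first exact: CD.
    by apply/ffunP=> i; rewrite !ffunE.
  apply/imsetP; exists (wscale a x); first exact: CZ.
  by apply/ffunP=> i; rewrite !ffunE.
have -> : min_dist (f @: C) (#|I| - k + 1) = min_dist (f @: C) (#|'I_#|I| | - k + 1).
  by rewrite card_ord.
apply: mds_min_dist; rewrite ?card_ord ?k0 //.
apply: mds_determined => // S cS _ _ /imsetP[x xC ->] /imsetP[y yC ->] e.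
congr f; apply: (dC [set enum_val i | i in S]) => //.
  by rewrite card_imset //; apply: enum_val_inj.
by move=> _ /imsetP[i iS ->]; have := e i iS; rewrite !ffunE.
Qed.

Lemma linear_MDS_existsE (K : finFieldType) m k : linear_MDS_exists K m k ->
  exists C : code 'I_m K, [/\ linear_code C, mds C k & (k <= m)%N].
Proof.
case=> C [lC cC dC]; exists C; split=> //; last by have := card_eq_le cC; rewrite card_ord.
by apply: min_dist_mds; rewrite ?card_ord.
Qed.

(** * Systematic generator matrices of linear MDS codes and their minors *)

Section LinearMDS.
Variables (I : finType) (K : finFieldType) (C : code I K) (k : nat).
Hypotheses (lC : linear_code C) (mC : mds C k).

Lemma mds_vanish (S : {set I}) x :
  #|S| = k -> x \in C -> (forall i, i \in S -> x i = 0) -> x = [ffun=> 0].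
Proof.
move=> cS xC x0; apply: (proj1 (mC cS)) => //; first exact: lC.1.
by move=> i iS; rewrite x0 // ffunE.
Qed.

(** These are the rows of the generator matrix that is the identity on the columns [S]. *)
Lemma unit_codewords (S : {set I}) : #|S| = k ->
  exists e : I -> {ffun I -> K}, forall j, j \in S ->
    [/\ e j \in C, e j j = 1 & forall i, i \in S -> i != j -> e j i = 0].
Proof.
move=> cS; pose P j c := j \in S ->
  [/\ c \in C, c j = 1 & forall i, i \in S -> i != j -> c i = 0].
apply: (@fin_all_exists _ _ P) => j.
have [c cC e] := proj2 (mC cS) (fun i => (i == j)%:R).
exists c => jS; split=> // [|i iS /negPf ij]; rewrite e ?eqxx ?ij //.
Qed.

Lemma card_exchange (S : {set I}) i j : j \in S -> i \notin S -> #|i |: S :\ j| = #|S|.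
Proof.
by move=> jS iS; rewrite cardsU1 !inE (negPf iS) andbF [in RHS](cardsD1 j) jS.
Qed.

Variables (S : {set I}) (e : I -> {ffun I -> K}).
Hypotheses (cS : #|S| = k)
  (eP : forall j, j \in S ->
    [/\ e j \in C, e j j = 1 & forall i, i \in S -> i != j -> e j i = 0]).

(** A zero there would let the nonzero row [e j] vanish on the [k] positions [i |: S :\ j]. *)
Lemma unit_codeword_neq0 i j : j \in S -> i \notin S -> e j i != 0.
Proof.
move=> jS iS; apply/eqP => eji; have [eC ejj ej0] := eP jS.
have /ffunP/(_ j)/eqP : e j = [ffun=> 0]; last by rewrite ejj ffunE oner_eq0.
apply: (mds_vanish (S := i |: S :\ j)); rewrite ?card_exchange //.
by move=> l; rewrite !inE => /orP[/eqP->//|/andP[lj lS]]; apply: ej0.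
Qed.

(** If this minor vanished, the combination of rows [j] and [j'] that is zero at [i'] would be zero
    at [i] too, hence on [k] positions, yet not at [j]. *)
Lemma unit_codeword_minor i i' j j' : i \notin S -> i' \notin S -> j \in S -> j' \in S ->
  i != i' -> j != j' -> e j i * e j' i' != e j' i * e j i'.
Proof.
move=> iS i'S jS j'S ii' jj'; apply/eqP=> E.
have [eC ejj ej0] := eP jS; have [eC' ejj' ej0'] := eP j'S.
pose x := wadd (wscale (e j' i') (e j)) (wscale (- e j i') (e j')).
have xC : x \in C by case: lC => _ [D Z]; apply: D; apply: Z.
have /ffunP/(_ j)/eqP : x = [ffun=> 0]; last first.
  rewrite !ffunE ejj (ej0' j) // mulr0 addr0 mulr1.
  by rewrite (negPf (unit_codeword_neq0 j'S i'S)).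
apply: (mds_vanish (S := i |: (i' |: S :\ j) :\ j')) => //.
  rewrite card_exchange ?card_exchange // !inE; first by rewrite (eq_sym j' j) jj' j'S orbT.
  by rewrite (negPf ii') (negPf iS) andbF.
move=> l; rewrite !inE => /orP[/eqP->|/andP[lj' /orP[/eqP->|/andP[lj lS]]]].
- by rewrite !ffunE mulrC E mulrC mulNr subrr.
- by rewrite !ffunE mulrC mulNr subrr.
by rewrite !ffunE (ej0 l) // (ej0' l) // !mulr0 addr0.
Qed.

Lemma linear_combination x : x \in C -> forall i, x i = \sum_(j in S) x j * e j i.
Proof.
case: lC => C0 [CD CZ] xC i.
pose y : {ffun I -> K} := \sum_(j in S) wscale (x j) (e j).
have yC : y \in C.
  rewrite /y; elim/big_ind: _ => [|u v uC vC|j jS].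
  - by rewrite (_ : 0 = [ffun=> 0]) //; apply/ffunP=> l; rewrite !ffunE.
  - by rewrite (_ : u + v = wadd u v) ?CD //; apply/ffunP=> l; rewrite !ffunE.
  - by apply: CZ; have [] := eP jS.
have yE l : y l = \sum_(j in S) x j * e j l.
  by rewrite sum_ffunE; apply: eq_bigr => j _; rewrite ffunE.
rewrite -yE; congr (fun_of_fin _ i); apply: (proj1 (mC cS)) => // l lS.
rewrite yE (bigD1 l) //= big1 ?addr0 => [|j /andP[jS jl]].
  by have [_ -> _] := eP lS; rewrite mulr1.
by have [_ _ ->] := eP jS; rewrite ?mulr0 // eq_sym.
Qed.

End LinearMDS.

(** * Bounds on the length of linear MDS codes over a given field *)

Lemma card_le_units (I : finType) (K : finFieldType) (S : {set I}) (f : I -> K) :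
  {in S &, injective f} -> (forall i, i \in S -> f i != 0) -> (#|S| < #|K|)%N.
Proof.
move=> finj f0; rewrite -(card_in_imset finj).
have -> : (#|K| = #|predC1 (0%R : K)|.+1)%N.
  by rewrite cardC1 prednK // ltnW ?(finNzRing_gt1 K).
rewrite ltnS; apply: subset_leq_card; apply/subsetP=> _ /imsetP[i iS ->].
exact: f0.
Qed.

(** For two rows [j], [j'], the quotients [e j i / e j' i] over the columns [i] outside [S] are
    nonzero, and distinct by the minors; so [m - k <= #|K| - 1]. *)
Lemma linear_MDS_length_le (K : finFieldType) m k : (1 < k)%N ->
  linear_MDS_exists K m k -> (m < #|K| + k)%N.
Proof.
move=> k1 /linear_MDS_existsE[C [lC mC km]].
have [S _ cS] : exists2 S : {set 'I_m}, set0 \subset S & #|S| = k.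
  by apply: set_between; rewrite cards0 card_ord.
have [e eP] := unit_codewords mC cS.
have /card_gt1P[j [j' [jS j'S jj']]] : (1 < #|S|)%N by rewrite cS.
have N0 := unit_codeword_neq0 lC mC cS eP.
suff : (#|~: S| < #|K|)%N by rewrite (cardsCs (~: S)) setCK card_ord cS; lia.
apply: (card_le_units (f := fun i => e j i / e j' i)) => [i i'|i];
  rewrite !inE; last by move=> iS; rewrite mulf_neq0 ?invr_eq0 ?N0.
move=> iS i'S /eqP; rewrite eqr_div ?N0 // => E; apply/eqP/contraT => ii'.
have := unit_codeword_minor lC mC cS eP iS i'S jS j'S ii' jj'.
by rewrite (eqP E) mulrC eqxx.
Qed.

(** The dual argument: the quotients of two columns outside [S], taken over the [k] rows, are
    distinct and nonzero. Two such columns exist because [k + 1 < m]. *)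
Lemma linear_MDS_dim_lt (K : finFieldType) m k :
  linear_MDS_exists K m k -> (k + 1 < m)%N -> (k < #|K|)%N.
Proof.
move=> /linear_MDS_existsE[C [lC mC km]] km1.
have [S _ cS] : exists2 S : {set 'I_m}, set0 \subset S & #|S| = k.
  by apply: set_between; rewrite cards0 card_ord.
have [e eP] := unit_codewords mC cS.
have /card_gt1P[i [i' [iS i'S ii']]] : (1 < #|~: S|)%N.
  by rewrite (cardsCs (~: S)) setCK card_ord cS; lia.
rewrite !inE in iS i'S.
have N0 := unit_codeword_neq0 lC mC cS eP.
rewrite -cS; apply: (card_le_units (f := fun j => e j i / e j i')) => [j j'|j] jS;
  last by rewrite mulf_neq0 ?invr_eq0 ?N0.
move=> j'S /eqP; rewrite eqr_div ?N0 // => E; apply/eqP/contraT => jj'.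
have := unit_codeword_minor lC mC cS eP iS i'S jS j'S ii' jj'.
by rewrite (eqP E) eqxx.
Qed.

(** In the zero-sum code any [k] entries fix the last one. *)
Lemma parity_check_MDS (K : finFieldType) k : (0 < k)%N -> linear_MDS_exists K k.+1 k.
Proof.
move=> k0; pose C : code 'I_k.+1 K := [set x | \sum_i (x : {ffun _ -> K}) i == 0].
have split_sum (x : {ffun 'I_k.+1 -> K}) (S : {set 'I_k.+1}) : #|S| = k ->
    exists2 j, j \notin S & (forall i, i \notin S -> i = j) /\
      \sum_i x i = x j + \sum_(i in S) x i.
  move=> cS; have /cards1P[j Sj] : #|~: S| == 1%N.
    by rewrite (cardsCs (~: S)) setCK card_ord cS; apply/eqP; lia.
  have jS i : (i \notin S) = (i == j) by rewrite -in_set1 -Sj inE.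
  exists j; first by rewrite jS.
  split=> [i|]; first by rewrite jS => /eqP.
  by rewrite (bigD1 j) //=; congr (_ + _); apply: eq_bigl => i; rewrite -jS negbK.
have lC : linear_code C.
  split; [|split=> [x y|a x]]; rewrite !inE.
  - by rewrite big1 // => i _; rewrite ffunE.
  - move=> /eqP x0 /eqP y0.
    by under eq_bigr => i _ do rewrite ffunE; rewrite big_split /= x0 y0 addr0.
  - move=> /eqP x0.
    by under eq_bigr => i _ do rewrite ffunE; rewrite -mulr_sumr x0 mulr0.
have dC (S : {set 'I_k.+1}) : #|S| = k -> determined_by C S.
  move=> cS x y; rewrite !inE => /eqP x0 /eqP y0 e.
  have [j jS [jj xE]] := split_sum x S cS; have [j' j'S [_ yE]] := split_sum y S cS.
  apply/ffunP=> i; case: (boolP (i \in S)) => [|iS]; first exact: e.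
  move: x0 y0; rewrite xE yE (jj _ iS) (jj _ j'S) (eq_bigr _ e) => x0 y0.
  by apply: (addIr (\sum_(i in S) y i)); rewrite x0 y0.
rewrite -[X in linear_MDS_exists K X k]card_ord.
apply: (@linear_MDS_exists_mds _ _ C) => //.
pose S := [set~ (ord0 : 'I_k.+1)].
have cS : #|S| = k by rewrite cardsC1 card_ord.
rewrite -[in RHS]cS; apply: card_interpolates; first exact: dC.
move=> f; exists [ffun i => if i == ord0 then - \sum_(i in S) f i else f i].
  rewrite inE (bigD1 ord0) //= ffunE eqxx.
  rewrite addrC subr_eq0; apply/eqP/eq_big => i; first by rewrite !inE.
  by rewrite ffunE => /negPf->.
by move=> i; rewrite !inE ffunE => /negPf->.
Qed.

(** The polynomials of degree below [k] are evaluated at all points of [K]; [k] values determine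
    such a polynomial. *)
Lemma reed_solomon_MDS (K : finFieldType) k : (0 < k <= #|K|)%N ->
  linear_MDS_exists K #|K| k.
Proof.
case/andP=> k0 kK.
pose f (u : {ffun 'I_k -> K}) : {ffun K -> K} :=
  [ffun x => (\poly_(i < k) oapp u 0 (insub i)).[x]].
have polyE (u : {ffun 'I_k -> K}) (i : 'I_k) :
    (\poly_(i < k) oapp u 0 (insub i))`_i = u i.
  by rewrite coef_poly ltn_ord valK.
have fE u : f u = [ffun x => \sum_(i < k) u i * x ^+ i].
  apply/ffunP=> x; rewrite !ffunE horner_poly; apply: eq_bigr => i _.
  by rewrite valK.
have finj u v (S : {set K}) : #|S| = k -> (forall x, x \in S -> f u x = f v x) -> u = v.
  move=> cS e; pose P := \poly_(i < k) oapp u 0 (insub i) - \poly_(i < k) oapp v 0 (insub i).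
  have /eqP : P == 0.
    apply: contraT => P0.
    have := max_poly_roots P0 (rs := enum S); rewrite enum_uniq -cardE cS => H.
    have : (k < size P)%N.
      apply: H => //; apply/allP=> x; rewrite mem_enum => xS.
      by rewrite rootE hornerD hornerN subr_eq0; have := e x xS; rewrite !ffunE => ->.
    rewrite ltnNge (leq_trans (size_polyD _ _)) // size_polyN geq_max.
    by rewrite !size_poly.
  move/eqP; rewrite subr_eq0 => /eqP/polyP PE.
  by apply/ffunP=> i; have := PE i; rewrite !polyE.
have [S0 _ cS0] : exists2 S : {set K}, set0 \subset S & #|S| = k.
  by apply: set_between; rewrite cards0.
apply: (@linear_MDS_exists_mds _ _ [set f u | u : {ffun 'I_k -> K}]) => //.
- split; [|split=> [_ _ /imsetP[u _ ->] /imsetP[v _ ->]|a _ /imsetP[u _ ->]]].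
  + apply/imsetP; exists [ffun=> 0] => //; apply/ffunP=> x.
    by rewrite fE !ffunE big1 // => i _; rewrite ffunE mul0r.
  + apply/imsetP; exists [ffun i => u i + v i] => //; apply/ffunP=> x.
    by rewrite !fE !ffunE -big_split; apply: eq_bigr => i _; rewrite ffunE mulrDl.
  + apply/imsetP; exists [ffun i => a * u i] => //; apply/ffunP=> x.
    by rewrite !fE !ffunE mulr_sumr; apply: eq_bigr => i _; rewrite ffunE mulrA.
- rewrite card_imset ?card_ffun ?card_ord // => u v e.
  by apply: (finj u v S0) => // x _; rewrite e.
- by move=> S cS _ _ /imsetP[u _ ->] /imsetP[v _ ->] e; rewrite (finj u v S).
Qed.

Lemma max_of_bounded (P : nat -> Prop) (m0 b : nat) : P m0 -> (forall m, P m -> (m <= b)%N) ->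
  exists2 N, P N & forall m, P m -> (m <= N)%N.
Proof.
move=> Pm0 Pb; have [d] := ubnP (b - m0)%N; elim: d m0 Pm0 => // d IH m0 Pm0 bd.
have [[m [Pm mm]]|H] := classic (exists m, P m /\ (m0 < m)%N).
  by apply: (IH m) => //; have := Pb m Pm; lia.
exists m0 => // m Pm; rewrite leqNgt; apply/negP=> mm; apply: H.
by exists m.
Qed.

(** The length hypotheses of the theorem quantify over maximal lengths [N]; applying them requires
    that one exists. *)
Lemma is_nmax_exists (K : finFieldType) k : (1 < k)%N -> exists N, is_nmax K k N.
Proof.
move=> k1; have := @max_of_bounded (fun m => linear_MDS_exists K m k) k.+1 (#|K| + k).
case=> [|m /(linear_MDS_length_le k1)/ltnW //|N PN maxN].
  exact/parity_check_MDS/ltnW.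
by exists N.
Qed.

(** * A linear MDS code with a second linear structure *)

Section SecondStructure.
Variables (U : finType) (L : finFieldType) (p m h k : nat).
Variables (N : code U L) (chi chi' : U -> L -> L).
Hypotheses (pP : prime p) (m0 : (0 < m)%N) (cL : #|L| = ((p ^ m) ^ h)%N).
Hypothesis k0 : (0 < k)%N.
Hypotheses (lN : linear_code N) (mN : mds N k).
Hypotheses (chiK : forall i, cancel (chi i) (chi' i))
           (chiK' : forall i, cancel (chi' i) (chi i))
           (chiL : forall i, Fsub_lin_map (p ^ m) (chi i)).
Hypothesis Nchi : forall l c, c \in N ->
  [ffun i => chi' i (l * chi i (c i))] \in N.

Lemma chi_eq0 i y : (chi i y == 0) = (y == 0).
Proof. by rewrite -[RHS](inj_eq (can_inj (chiK i))) (lin_map0 (chiL i)). Qed.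

Variables (S : {set U}) (e : U -> {ffun U -> L}).
Hypotheses (cS : #|S| = k)
  (eP : forall j, j \in S ->
    [/\ e j \in N, e j j = 1 & forall i, i \in S -> i != j -> e j i = 0]).

(** The second action sends a multiple of [e j], a codeword of minimum weight, to a codeword that
    still vanishes on [S :\ j], hence again to a multiple of [e j]; coordinates [i] and [j] are then
    compared. *)
Lemma chi_unit_codeword i j : j \in S -> i \notin S ->
  exists2 kap, kap != 0 & forall y, chi i (e j i * y) = kap * chi j y.
Proof.
move=> jS iS; have [eN ejj ej0] := eP jS.
have chi'0 l : chi' l 0 = 0 by apply/eqP; rewrite -(chi_eq0 l) chiK'.
have key l x : chi' i (l * chi i (x * e j i)) = chi' j (l * chi j x) * e j i.
  have cN : wscale x (e j) \in N by apply: (proj2 lN).2.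
  have := linear_combination lN mN cS eP (Nchi l cN) i.
  rewrite (bigD1 j) //= big1 ?addr0 => [|u /andP[uS uj]]; last first.
    by rewrite !ffunE ej0 // mulr0 (lin_map0 (chiL u)) mulr0 chi'0 mul0r.
  by rewrite !ffunE ejj mulr1.
exists (chi i (chi' j 1 * e j i)) => [|y].
  rewrite chi_eq0 mulf_neq0 ?(unit_codeword_neq0 lN mN cS eP) //.
  by rewrite -(chi_eq0 j) chiK' oner_eq0.
(* With [l = chi j y] and [x = chi' j 1] the right side of [key] becomes [y * e j i]. *)
have := congr1 (chi i) (key (chi j y) (chi' j 1)).
by rewrite !chiK' mulr1 chiK mulrC => ->; rewrite mulrC.
Qed.

Variables (i0 j0 : U).
Hypotheses (i0S : i0 \notin S) (j0S : j0 \in S).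

(* Scaling coordinate [i] by [rho i] brings the generator matrix over [multipliers]. *)
Definition rho i := if i \in S then e i i0 else e j0 i0 / e j0 i.

Lemma rho_neq0 i : rho i != 0.
Proof.
have N0 := unit_codeword_neq0 lN mN cS eP.
by rewrite /rho; case: ifPn => iS; rewrite ?mulf_neq0 ?invr_eq0 ?N0.
Qed.

(** For [i] in [S] this is [chi_unit_codeword] in column [i0]; for [i] outside, row [j0] links [i]
    to [i0]. *)
Lemma chi_rho i : exists2 kap, kap != 0 & forall y, chi i y = kap * chi i0 (rho i * y).
Proof.
have N0 := unit_codeword_neq0 lN mN cS eP.
have HS j : j \in S -> exists2 kap, kap != 0 & forall y, chi j y = kap * chi i0 (e j i0 * y).
  move=> jS; have [kap kap0 kapE] := chi_unit_codeword jS i0S.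
  by exists kap^-1 => [|y]; rewrite ?invr_eq0 // kapE mulKf.
rewrite /rho; case: ifPn => iS; first exact: HS.
have [u u0 uE] := chi_unit_codeword j0S iS; have [v v0 vE] := HS j0 j0S.
exists (u * v) => [|y]; first by rewrite mulf_neq0.
rewrite -{1}(mulVKf (N0 i j0 j0S iS) y) uE vE mulrA; congr (_ * chi i0 _).
by rewrite mulrA.
Qed.

(** The field [Z]. It contains every [a] with [a ^+ (p ^ m) = a], since [chi i0] commutes with these
    scalars. *)
Definition multipliers : {pred L} :=
  [pred x | [exists x', [forall y, chi i0 (x * y) == x' * chi i0 y]]].

Lemma multipliersP x :
  reflect (exists x', forall y, chi i0 (x * y) = x' * chi i0 y) (x \in multipliers).
Proof.
apply: (iffP existsP) => -[x' xx']; exists x'; last by apply/forallP=> y; apply/eqP.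
by move=> y; apply/eqP/(forallP xx').
Qed.

Lemma multipliers_divring : divring_closed multipliers.
Proof.
split=> [|x y /multipliersP[x' xx'] /multipliersP[y' yy']|
          x y /multipliersP[x' xx'] /multipliersP[y' yy']]; apply/multipliersP.
- by exists 1 => y; rewrite !mul1r.
- by exists (x' - y') => z; rewrite !mulrBl (lin_mapB (chiL i0)) xx' yy'.
have [->|y0] := eqVneq y 0.
  by exists 0 => z; rewrite invr0 mulr0 !mul0r (lin_map0 (chiL i0)).
have y'0 : y' != 0.
  apply/eqP=> y'0; have /eqP := yy' 1; rewrite y'0 mul0r chi_eq0 mulr1.
  by rewrite (negPf y0).
exists (x' / y') => z; rewrite -[x / y * z]mulrA xx' -mulrA; congr (_ * _).
by apply: (mulfI y'0); rewrite -yy' !mulVKf.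
Qed.

(** This is an entry of the rescaled generator matrix. For [i] outside [S], writing [chi i] and
    [chi j] through [chi i0] turns [chi_unit_codeword] into the multiplier property. *)
Lemma rho_multiplier i j : j \in S -> rho i * e j i / rho j \in multipliers.
Proof.
move=> jS; have [eN ejj ej0] := eP jS; have [iS|iS] := boolP (i \in S).
  have [->|ij] := eqVneq i j.
    rewrite ejj mulr1 mulfV ?rho_neq0 //; by have [] := multipliers_divring.
  rewrite ej0 // mulr0 mul0r; apply/multipliersP; exists 0 => y.
  by rewrite !mul0r (lin_map0 (chiL i0)).
have [u u0 uE] := chi_unit_codeword jS iS.
have [v v0 vE] := chi_rho i; have [w w0 wE] := chi_rho j.
apply/multipliersP; exists (v^-1 * u * w) => y.
have := uE ((rho j)^-1 * y); rewrite vE wE mulVKf ?rho_neq0 // => E.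
by apply: (mulfI v0); rewrite -!mulrA mulVKf // -E.
Qed.

(** [theta] generates the units of [Z], its companion under [chi i0] is a Frobenius conjugate, and
    the scalars linking [chi i] to [chi i0] commute with both. *)
Lemma second_structure :
  exists s (K : finFieldType) (theta : L) j,
  [/\ (0 < s)%N && (s %| h)%N, #|K| = ((p ^ m) ^ s)%N,
      linear_MDS_exists K #|U| k, (((p ^ m) ^ s).-1).-primitive_root theta &
      forall i y, chi i (theta * y) = theta ^+ ((p ^ m) ^ j) * chi i y].
Proof.
have Lp : p \in [pchar L] by apply: (card_finPcharP (n := (m * h)%N)); rewrite // expnM.
have [K [iota iotaP]] := subfield_type multipliers_divring.
have [s sP cK] : exists2 s, (0 < s)%N && (s %| h)%N & #|K| = ((p ^ m) ^ s)%N.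
  apply: (card_subfield (iota := iota)) => // a aq.
  by apply/iotaP/multipliersP; exists a => y; apply: (chiL i0).2.
have [z zP] := finField_prim_root K.
have [th' thE] : exists x', forall y, chi i0 (iota z * y) = x' * chi i0 y.
  by apply/multipliersP/iotaP; exists z.
have [j jE] : exists j, th' = iota z ^+ ((p ^ m) ^ j).
  apply: (frob_conj Lp (s := s) (chi := chi i0)) => //.
  - by case/andP: sP.
  - by rewrite chi_eq0 oner_eq0.
  - by rewrite -rmorphXn -cK expf_card.
exists s, K, (iota z), j; split=> //; first last.
- move=> i y; have [kap _ kapE] := chi_rho i.
  by rewrite !kapE mulrCA thE jE mulrCA.
- by rewrite fmorph_primitive_root -cK.
pose D : code U K := [set v | [exists c in N, [forall i,
  iota ((v : {ffun U -> K}) i) == rho i * (c : {ffun U -> L}) i]]].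
have DP (v : {ffun U -> K}) :
    reflect (exists2 c, c \in N & forall i, iota (v i) = rho i * c i) (v \in D).
  rewrite inE; apply: (iffP existsP) => [[c /andP[cN /forallP H]]|[c cN H]]; exists c => //.
    by move=> i; apply/eqP.
  by rewrite cN; apply/forallP=> i; apply/eqP.
have dD (T : {set U}) : #|T| = k -> determined_by D T.
  move=> cT v w /DP[c cN vE] /DP[d dN wE] vw.
  have cd : c = d.
    apply: (proj1 (mN cT)) => // i iT; apply: (mulfI (rho_neq0 i)).
    by rewrite -vE -wE vw.
  by apply/ffunP=> i; apply: (fmorph_inj iota); rewrite vE wE cd.
case: (lN) => N0 [ND NZ].
apply: (linear_MDS_exists_mds (C := D)) => //; first split; [|split|].
- by apply/DP; exists [ffun=> 0] => // i; rewrite !ffunE rmorph0 mulr0.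
- move=> v w /DP[c cN vE] /DP[d dN wE]; apply/DP; exists (wadd c d); first exact: ND.
  by move=> i; rewrite !ffunE rmorphD vE wE mulrDr.
- move=> a v /DP[c cN vE]; apply/DP; exists (wscale (iota a) c); first exact: NZ.
  by move=> i; rewrite !ffunE rmorphM vE mulrCA.
rewrite -[in RHS]cS; apply: card_interpolates; first exact: dD.
(* Values over [K] prescribed on [S] extend: every entry is a combination of the [f l] with
   coefficients [rho i * e l i / rho l], which lie in [Z]. *)
move=> f; have [c cN cE] := proj2 (mN cS) (fun i => iota (f i) / rho i).
have : forall i, exists v, iota v = rho i * c i.
  move=> i; rewrite (linear_combination lN mN cS eP cN) mulr_sumr.
  elim/big_ind: _ => [|_ _ [u <-] [v <-]|l lS].
  - by exists 0; rewrite rmorph0.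
  - by exists (u + v); rewrite rmorphD.
  have [v vE] := proj1 (iotaP _) (rho_multiplier i lS).
  by exists (f l * v); rewrite rmorphM vE cE //; ring.
case/fin_all_exists=> v vE; exists (finfun v).
  by apply/DP; exists c => // i; rewrite ffunE vE.
move=> i iS; apply: (fmorph_inj iota).
by rewrite ffunE vE cE // mulrC mulfVK ?rho_neq0.
Qed.

End SecondStructure.

(** Scalar multiplication in [D] is carried back through the equivalence to the codewords of [C]
    vanishing on [A]. *)
Lemma proj_equiv_linear (I : finType) (L : finFieldType) r (C : code I L) (A : {set I}) :
  (exists D : code {i : I | i \notin A} L, linear_code D /\ Fsub_equiv r (proj C A) D) ->
  exists phi phi' : I -> L -> L,
  [/\ forall i, cancel (phi i) (phi' i), forall i, cancel (phi' i) (phi i),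
      forall i, Fsub_lin_map r (phi i) &
      forall l c, c \in C -> (forall i, i \in A -> c i = 0) ->
        [ffun i => phi' i (l * phi i (c i))] \in C].
Proof.
case=> D [[_ [_ DZ]] [sigma [ph [[sigma' sK sK'] phP DP]]]].
(* On [A], where the codewords concerned are zero, [phi] is filled in by the identity. *)
pose phi (i : I) := oapp ph id (insub i).
have phiE (j : {i | i \notin A}) : phi (val j) = ph j by rewrite /phi valK.
have phiL i : Fsub_lin_map r (phi i).
  by rewrite /phi; case: insubP => [j _ _|_] //=; have [] := phP j.
have phi_inj i : injective (phi i).
  by rewrite /phi; case: insubP => [j _ _|_] //=; have [_ /bij_inj] := phP j.
pose phi' i := invF (phi_inj i).
have phiK i : cancel (phi i) (phi' i) by apply: invF_f.
have phiK' i : cancel (phi' i) (phi i) by apply: f_invF.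
exists phi, phi'; split=> // l c cC c0.
pose x : {ffun {i | i \notin A} -> L} := [ffun j => c (val j)].
have xP : x \in proj C A.
  apply/imsetP; exists c; rewrite // inE cC; apply/forallP=> i; apply/implyP=> iA.
  by rewrite c0.
pose y : {ffun {i | i \notin A} -> L} := [ffun j => ph (sigma' j) (x (sigma' j))].
have yD : y \in D by apply/DP; exists x => // i; rewrite ffunE sK.
have /DP[x' /imsetP[d]] := DZ l _ yD; rewrite inE => /andP[dC /forallP d0] -> E.
suff -> : [ffun i => phi' i (l * phi i (c i))] = d by [].
apply/ffunP=> i; rewrite ffunE; have [iA|iA] := boolP (i \in A).
  have := d0 i; rewrite iA => /eqP->; rewrite c0 // (lin_map0 (phiL i)) mulr0.
  by rewrite -[X in phi' i X](lin_map0 (phiL i)) phiK.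
have := E (exist _ i iA); rewrite !ffunE sK -phiE /= => ->.
by rewrite phiK.
Qed.

(** * Gluing the two linear structures *)

Section Shortening.
Variables (I : finType) (L : finFieldType) (C : code I L) (T : {set I}) (k r : nat).
Variables (phi phi' : I -> L -> L).
Hypotheses (phiK : forall i, cancel (phi i) (phi' i)) (phiK' : forall i, cancel (phi' i) (phi i))
  (phiL : forall i, Fsub_lin_map r (phi i)).

(** Applying [phi] while deleting [T] turns the action [phi' i (l * phi i _)] into plain scalar
    multiplication. *)
Definition shortening : code {i | i \notin T} L :=
  [set y | [exists c in C, [forall i in T, (c : {ffun I -> L}) i == 0] &&
    [forall j, (y : {ffun {i | i \notin T} -> L}) j == phi (val j) ((c : {ffun I -> L}) (val j))]]].

Lemma shorteningP (y : {ffun {i | i \notin T} -> L}) :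
  reflect (exists c : {ffun I -> L}, [/\ c \in C, forall i, i \in T -> c i = 0 &
             forall j, y j = phi (val j) (c (val j))]) (y \in shortening).
Proof.
rewrite inE; apply: (iffP existsP) => [[c /and3P[cC /forallP c0 /forallP yE]]|[c [cC c0 yE]]].
  exists c; split=> // [i iT|j]; last exact/eqP.
  by have := c0 i; rewrite iT => /eqP.
exists c; rewrite cC /=; apply/andP; split; apply/forallP=> i; last exact/eqP.
by apply/implyP=> iT; rewrite c0.
Qed.

Lemma shortening_linear : [ffun=> 0] \in C ->
  (forall x y, x \in C -> y \in C -> wadd x y \in C) ->
  (forall l c, c \in C -> (forall i, i \in T -> c i = 0) ->
     [ffun i => phi' i (l * phi i (c i))] \in C) ->
  linear_code shortening.
Proof.
move=> C0 CD CZ; split; [|split].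
- apply/shorteningP; exists [ffun=> 0]; split=> // [i iT|j]; rewrite !ffunE //.
  by rewrite (lin_map0 (phiL _)).
- move=> x y /shorteningP[c [cC c0 xE]] /shorteningP[d [dC d0 yE]].
  apply/shorteningP; exists (wadd c d); split=> [|i iT|j]; first exact: CD.
    by rewrite ffunE c0 // d0 // addr0.
  by rewrite !ffunE xE yE; have [-> _] := phiL (val j).
move=> a x /shorteningP[c [cC c0 xE]]; apply/shorteningP.
exists [ffun i => phi' i (a * phi i (c i))]; split=> [|i iT|j]; first exact: CZ.
  by rewrite ffunE c0 // (lin_map0 (phiL i)) mulr0 -[X in phi' i X](lin_map0 (phiL i)) phiK.
by rewrite !ffunE phiK' xE.
Qed.

Lemma shortening_mds : mds C k -> (#|T| <= k)%N -> mds shortening (k - #|T|).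
Proof.
move=> mC Tk S cS; pose S' : {set I} := T :|: [set val j | j in S].
have cS' : #|S'| = k.
  rewrite cardsU (_ : T :&: _ = set0) ?cards0.
    by rewrite card_imset ?cS; [lia | exact: val_inj].
  apply/setP=> i; rewrite !inE; apply/andP=> -[iT /imsetP[j _ ij]].
  by have := valP j; rewrite -ij iT.
have [dC iC] := mC _ cS'; split.
  move=> x y /shorteningP[c [cC c0 xE]] /shorteningP[d [dC' d0 yE]] xy.
  have cd : c = d.
    apply: dC => // i; rewrite inE => /orP[iT|/imsetP[j jS ->]]; first by rewrite c0 ?d0.
    by apply: (can_inj (phiK (val j))); rewrite -xE -yE xy.
  by apply/ffunP=> j; rewrite xE yE cd.
(* The default [0] of [oapp] is the value prescribed on [T]. *)
move=> f; have [c cC cE] := iC (fun i => oapp (fun j => phi' i (f j)) 0 (insub i)).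
exists [ffun j => phi (val j) (c (val j))].
  apply/shorteningP; exists c; split=> // [i iT|j]; last by rewrite ffunE.
  by rewrite cE ?inE ?iT // insubF // iT.
move=> j jS; rewrite ffunE cE; first by rewrite valK /= phiK'.
by rewrite inE; apply/orP; right; apply: imset_f.
Qed.

End Shortening.

Lemma card_notin (I : finType) (T : {set I}) : #|{: {i | i \notin T}}| = (#|I| - #|T|)%N.
Proof.
rewrite card_sig -[in RHS](setCK T) -cardsCs; apply: eq_card => i; rewrite inE /=.
by rewrite in_setC.
Qed.

(** Interpolation on an information set containing both [A] and [B] gives [a] that is zero on [A]
    and equal to [c] on [B], so [c - a] vanishes on [B]. *)
Lemma mds_split (I : finType) (L : finFieldType) (C : code I L) k (A B : {set I}) :
  mds C k -> [disjoint A & B] -> (#|A :|: B| <= k <= #|I|)%N ->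
  (forall x y, x \in C -> y \in C -> [ffun i => x i - y i] \in C) ->
  forall c, c \in C -> exists a b, [/\ a \in C, b \in C, c = wadd a b,
    forall i, i \in A -> a i = 0 & forall i, i \in B -> b i = 0].
Proof.
move=> mC dAB kI CB c cC; have [S AS cS] := set_between kI.
have [a aC aE] := proj2 (mC S cS) (fun i => if i \in A then 0 else c i).
exists a, [ffun i => c i - a i]; split=> //; first exact: CB.
- by apply/ffunP=> i; rewrite !ffunE addrCA subrr addr0.
- by move=> i iA; rewrite aE ?iA // (subsetP AS) // inE iA.
- move=> i iB; rewrite ffunE aE; last by rewrite (subsetP AS) // inE iB orbT.
  by rewrite (disjointFl dAB iB) subrr.
Qed.

(** Each nonzero [a] with [a ^+ r = a] is a power of [theta]. *)
Lemma Fsub_linear_generator (I : finType) (L : finFieldType) (D : code I L) r (theta : L) :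
  (r.-1).-primitive_root theta -> [ffun=> 0] \in D ->
  (forall x y, x \in D -> y \in D -> wadd x y \in D) ->
  (forall x, x \in D -> wscale theta x \in D) -> Fsub_linear r D.
Proof.
move=> thP D0 DD Dth; split=> //; split=> // a x /eqP ar xD.
have [->|a0] := eqVneq a 0.
  by rewrite (_ : wscale 0 x = [ffun=> 0]) //; apply/ffunP=> i; rewrite !ffunE mul0r.
have r0 : (0 < r)%N by have := prim_order_gt0 thP; case: (r).
have : a ^+ r.-1 = 1 by apply: (mulfI a0); rewrite -exprS prednK // mulr1.
case/(prim_rootP thP) => -[j _] /= ->; elim: j => [|j IH].
  by rewrite (_ : wscale _ x = x) //; apply/ffunP=> i; rewrite ffunE mul1r.
have := Dth _ IH; congr (_ \in D); apply/ffunP=> i.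
by rewrite !ffunE exprS mulrA.
Qed.

Lemma glue_projections (p m h k : nat) (I : finType) (L : finFieldType) (C : code I L)
  (A B : {set I}) (q := (p ^ m)%N) :
  prime p -> (0 < m)%N -> #|L| = (q ^ h)%N -> Fsub_linear q C -> mds C k ->
  [disjoint A & B] -> (#|A :|: B| < k)%N -> (k < #|I|)%N ->
  (exists D : code {i : I | i \notin A} L, linear_code D /\ Fsub_equiv q (proj C A) D) ->
  (exists D : code {i : I | i \notin B} L, linear_code D /\ Fsub_equiv q (proj C B) D) ->
  exists s (K : finFieldType), [/\ (0 < s)%N && (s %| h)%N, #|K| = (q ^ s)%N,
    linear_MDS_exists K (#|I| - #|A :|: B|) (k - #|A :|: B|) &
    exists D : code I L, Fsub_linear (q ^ s) D /\ Fsub_equiv q C D].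
Proof.
move=> pP m0 cL [C0 [CD CZ]] mC dAB Tk kI.
move=> /proj_equiv_linear[phi [phi' [phiK phiK' phiL Cphi]]].
move=> /proj_equiv_linear[psi [psi' [psiK psiK' psiL Cpsi]]].
have Lp : p \in [pchar L].
  by apply: (card_finPcharP (n := (m * h)%N)); rewrite // expnM.
have phi0 i : phi i 0 = 0 := lin_map0 (phiL i).
have psi0 i : psi i 0 = 0 := lin_map0 (psiL i).
have phi'0 i : phi' i 0 = 0 by rewrite -[X in phi' i X](phi0 i) phiK.
have psi'0 i : psi' i 0 = 0 by rewrite -[X in psi' i X](psi0 i) psiK.
set T := A :|: B in Tk *.
have TA c : (forall i, i \in T -> c i = 0 :> L) -> forall i, i \in A -> c i = 0.
  by move=> c0 i iA; apply: c0; rewrite inE iA.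
have TB c : (forall i, i \in T -> c i = 0 :> L) -> forall i, i \in B -> c i = 0.
  by move=> c0 i iB; apply: c0; rewrite inE iB orbT.
pose U := {i | i \notin T}.
pose N := shortening C T phi.
have lN : linear_code N.
  by apply: (shortening_linear phiK phiK' phiL C0 CD) => l c cC /TA; apply: Cphi.
have mN : mds N (k - #|T|) .
  by apply: shortening_mds phiK phiK' mC (ltnW Tk).
have cU : #|{: U}| = (#|I| - #|T|)%N.
  exact: card_notin.
pose chi (j : U) := psi (val j) \o phi' (val j).
pose chi' (j : U) := phi (val j) \o psi' (val j).
have chiK j : cancel (chi j) (chi' j) by move=> x; rewrite /chi /chi' /= psiK phiK'.
have chiK' j : cancel (chi' j) (chi j) by move=> x; rewrite /chi /chi' /= phiK psiK'.
have chiL j : Fsub_lin_map q (chi j).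
  by apply: lin_map_comp => //; apply: lin_map_can (phiL _).
(* Read through [phi], the action coming from [B] becomes [chi' i (l * chi i _)] on [N]. *)
have Nchi l c : c \in N -> [ffun i => chi' i (l * chi i (c i))] \in N.
  move=> /shorteningP[d [dC d0 cE]]; apply/shorteningP.
  exists [ffun i => psi' i (l * psi i (d i))]; split=> [|i iT|j].
  - by apply: Cpsi => //; apply: TB.
  - by rewrite ffunE d0 // psi0 mulr0 psi'0.
  - by rewrite !ffunE /chi /chi' /= cE phiK.
have kT0 : (0 < k - #|T|)%N by lia.
have kTU : (k - #|T| < #|{: U}|)%N by rewrite cU; lia.
have [S _ cS] : exists2 S : {set U}, set0 \subset S & #|S| = (k - #|T|)%N.
  by apply: set_between; rewrite cards0 (ltnW kTU).
have [e eP] := unit_codewords mN cS.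
have /card_gt0P[j0 j0S] : (0 < #|S|)%N by rewrite cS.
have /card_gt0P[i0] : (0 < #|~: S|)%N by rewrite (cardsCs (~: S)) setCK cS subn_gt0.
rewrite inE => i0S.
have [s [K [theta [j [sP cK KMDS thP thE]]]]] :=
  second_structure pP m0 cL kT0 lN mN chiK chiK' chiL Nchi cS eP i0S j0S.
exists s, K; split=> //; first by rewrite -cU.
pose tau (x : L) := x ^+ (q ^ j).
have tauL : Fsub_lin_map q tau := frob_lin_map m j Lp.
have tau_inj : injective tau.
  move=> x y xy; apply/eqP; rewrite -subr_eq0; move/eqP: xy.
  by rewrite -subr_eq0 -(lin_mapB tauL) expf_eq0 => /andP[].
have tauM x y : tau (x * y) = tau x * tau y by apply: exprMn.
pose tau' := invF tau_inj.
have tauK : cancel tau tau' by apply: invF_f.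
have tauK' : cancel tau' tau by apply: f_invF.
(* Outside [T], multiplication by [theta] through [phi] is multiplication by [tau theta] through
   [psi]. On [A], where only the action from [B] carries information, [psi] is used with the twist
   undone by [tau']. *)
pose eta i := if i \in A then tau' \o psi i else phi i.
have etaL i : Fsub_lin_map q (eta i).
  rewrite /eta; case: ifP => // _; apply: lin_map_comp => //.
  exact: lin_map_can tauL.
have eta_bij i : bijective (eta i).
  rewrite /eta; case: ifP => _; last by exists (phi' i).
  by apply: bij_comp; [exists tau | exists (psi' i)].
pose f (c : {ffun I -> L}) : {ffun I -> L} := [ffun i => eta i (c i)].
exists (f @: C); split; last first.
  exists id, eta; split=> [|//|y]; first by exists id.
  split=> [/imsetP[x xC ->]|[x xC xE]]; first by exists x => // i; rewrite ffunE.
  by apply/imsetP; exists x => //; apply/ffunP=> i; rewrite xE ffunE.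
have fD x y : f (wadd x y) = wadd (f x) (f y).
  by apply/ffunP=> i; rewrite !ffunE; have [-> _] := etaL i.
have DD x y : x \in f @: C -> y \in f @: C -> wadd x y \in f @: C.
  by move=> /imsetP[c cC ->] /imsetP[d dC ->]; rewrite -fD; apply: imset_f; apply: CD.
apply: (Fsub_linear_generator thP) => //.
  apply/imsetP; exists [ffun=> 0] => //; apply/ffunP=> i; rewrite !ffunE.
  by rewrite (lin_map0 (etaL i)).
(* Closure is given for sums and for scalars of the small field only, so [-1] is first placed in
   that field. *)
have CB x y : x \in C -> y \in C -> [ffun i => x i - y i] \in C.
  move=> xC yC; have FN : Fsub q (-1 : L).
    rewrite /Fsub exprNn_pchar ?expr1n // /q.
    by rewrite pnatX pnatE ?Lp ?(pcharf_prime Lp).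
  rewrite (_ : finfun _ = wadd x (wscale (-1) y)); first by apply: CD => //; apply: CZ.
  by apply/ffunP=> i; rewrite !ffunE mulN1r.
have kI' : (#|A :|: B| <= k <= #|I|)%N by rewrite (ltnW Tk) (ltnW kI).
move=> _ /imsetP[c cC ->].
have [a [b [aC bC -> a0 b0]]] := mds_split mC dAB kI' CB cC.
have -> : wscale theta (f (wadd a b)) = wadd (wscale theta (f a)) (wscale theta (f b)).
  by rewrite fD; apply/ffunP=> i; rewrite !ffunE mulrDr.
apply: DD; apply/imsetP.
  (* The summand [a] moves by the action from [A]: both sides vanish on [A], and [eta] is [phi]
     elsewhere. *)
  exists [ffun i => phi' i (theta * phi i (a i))]; first exact: Cphi.
  apply/ffunP=> i; rewrite !ffunE /eta; case: ifP => [iA|_]; last by rewrite phiK'.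
  by rewrite a0 // phi0 mulr0 phi'0 /= psi0 (lin_map0 (lin_map_can tauK tauK' tauL)) mulr0.
(* The summand [b] moves by [tau theta] under the action from [B]: on [A] the map [tau'] restores
   [theta], on [B] both sides vanish, and outside [T] the relation [thE] applies. *)
exists [ffun i => psi' i (tau theta * psi i (b i))]; first exact: Cpsi.
apply/ffunP=> i; rewrite !ffunE /eta; case: ifPn => [iA|iA] /=.
  rewrite psiK'; apply: (can_inj tauK).
  by rewrite tauM !tauK'.
have [iB|iB] := boolP (i \in B); first by rewrite b0 // psi0 mulr0 psi'0 phi0 mulr0.
have iT : i \notin T by rewrite inE negb_or iA.
have := thE (exist _ i iT) (phi i (b i)); rewrite /chi /= phiK -/(tau theta) => <-.
by rewrite psiK phiK'.
Qed.

Theorem theorem5p7 (p m q h k n : nat) (L : finFieldType) (C : code 'I_n L)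
  (A B : {set 'I_n}) :
  prime p -> (0 < m)%N -> q = (p ^ m)%N -> (1 <= h)%N -> #|L| = (q ^ h)%N ->
  (3 < k)%N ->
  Fsub_linear q C -> #|C| = (q ^ (h * k))%N -> min_dist C (n - k + 1) ->
  A :&: B = set0 -> (#|A| + #|B| <= k - 2)%N ->
  (exists D : code {i : 'I_n | i \notin A} L, linear_code D /\ Fsub_equiv q (proj C A) D) ->
  (exists D : code {i : 'I_n | i \notin B} L, linear_code D /\ Fsub_equiv q (proj C B) D) ->
  ((forall (K : finFieldType) (N : nat), #|K| = q -> is_nmax K (k - #|A :|: B|) N ->
       (#|A :|: B| + N < n)%N) ->
     exists s, [/\ (1 < s)%N, (s %| h)%N &
       exists D : code 'I_n L, Fsub_linear (q ^ s) D /\ Fsub_equiv q C D])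
  /\
  (forall e : nat, (e %| h)%N -> (e < h)%N ->
     (forall d, (d %| h)%N -> (d < h)%N -> (d <= e)%N) ->
     (forall (K : finFieldType) (N : nat), #|K| = (q ^ e)%N -> is_nmax K (k - #|A :|: B|) N ->
       (#|A :|: B| + N < n)%N) ->
     exists D : code 'I_n L, linear_code D /\ Fsub_equiv q C D).
Proof.
move=> pP m0 -> h0 cL k3 lC cC dC AB0 ABk HA HB.
have cAB : #|A :|: B| = (#|A| + #|B|)%N by rewrite cardsU AB0 cards0 subn0.
have dAB : [disjoint A & B] by rewrite -setI_eq0 AB0.
have mC : mds C k by apply: min_dist_mds; rewrite ?card_ord // cC cL expnM.
set T := A :|: B in cAB *; set k' := (k - #|T|)%N.
have k'1 : (1 < k')%N by rewrite /k'; lia.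
have Tk : (#|T| < k)%N by lia.
have lb (K : finFieldType) N : is_nmax K k' N -> (k' < N)%N.
  by case=> _; apply; apply/parity_check_MDS/ltnW.
have glue : (k < n)%N -> exists s (K : finFieldType),
    [/\ (0 < s)%N && (s %| h)%N, #|K| = ((p ^ m) ^ s)%N, linear_MDS_exists K (n - #|T|) k' &
      exists D : code 'I_n L, Fsub_linear ((p ^ m) ^ s) D /\ Fsub_equiv (p ^ m) C D].
  move=> kn; have := glue_projections pP m0 cL lC mC dAB Tk _ HA HB.
  by rewrite card_ord => /(_ kn).
(* An actual field with [(p ^ m) ^ e] elements and its maximal length make the hypothesis usable;
   since [N > k'], it also yields [k < n]. *)
have long e : (0 < e)%N ->
    (forall (K : finFieldType) N, #|K| = ((p ^ m) ^ e)%N -> is_nmax K k' N ->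
       (#|T| + N < n)%N) ->
    (k < n)%N /\ exists2 N, (#|T| + N < n)%N & exists2 K : finFieldType,
      #|K| = ((p ^ m) ^ e)%N & is_nmax K k' N.
  move=> e0 HN; have [|K _ cK] := @pPrimePowerField p (m * e) pP; first by rewrite muln_gt0 m0.
  rewrite expnM in cK; have [N NP] := is_nmax_exists K k'1.
  have lt := HN K N cK NP; split; last by exists N => //; exists K.
  by have := lb K N NP; rewrite /k'; lia.
split=> [HN|e eh elt emax HN].
  have [|kn _] := long 1%N isT; first by move=> K N; rewrite expn1; apply: HN.
  have [s [K [/andP[s0 sh] cK KM DP]]] := glue kn.
  (* [s = 1] would give an MDS code of length [n - #|T|], beyond the maximum over [p ^ m]
     elements. *)
  exists s; split=> //; rewrite ltn_neqAle s0 andbT; apply/eqP=> s1.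
  have [N NP] := is_nmax_exists K k'1.
  have := HN K N; rewrite cK -s1 expn1 => /(_ erefl NP).
  by have := proj2 NP _ KM; lia.
have e0 : (0 < e)%N by apply: dvdn_gt0 eh.
have [kn [N lt [Ke cKe NP]]] := long e e0 HN.
have [s [K [/andP[s0 sh] cK KM [D [DL DE]]]]] := glue kn.
have [sh'|sh'] := eqVneq s h.
  exists D; split=> //; case: DL => D0 [DD DZ]; split=> //; split=> // a x.
  by apply: DZ; rewrite /Fsub sh' -cL expf_card.
have slt : (s < h)%N by rewrite ltn_neqAle sh' dvdn_leq.
(* [s = e] contradicts the length hypothesis at once. For [s < e] the contradictory chain is [n -
   #|T| < #|K| + k' < 2 * #|K| <= #|Ke| <= N < n - #|T|]. *)
exfalso; have := emax s sh slt; rewrite leq_eqVlt => /orP[/eqP se|se].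
  have [N' NP'] := is_nmax_exists K k'1.
  have := HN K N'; rewrite cK se => /(_ erefl NP').
  by have := proj2 NP' _ KM; lia.
(* Since [k' < N < n - #|T|], the length over [K] exceeds [k' + 1]. *)
have K1 : (k' < #|K|)%N.
  by apply: (linear_MDS_dim_lt KM); have := lb _ _ NP; lia.
have nK := linear_MDS_length_le k'1 KM.
have q1 : (1 < p ^ m)%N by rewrite -{1}(exp1n m) ltn_exp2r ?prime_gt1.
have KKe : (2 * #|K| <= #|Ke|)%N.
  rewrite cK cKe; apply: leq_trans (_ : (p ^ m) ^ s.+1 <= _)%N; last by rewrite leq_exp2l.
  by rewrite expnS leq_mul2r q1 orbT.
have : (#|Ke| <= N)%N.
  by apply: (proj2 NP); apply: reed_solomon_MDS; lia.
lia.
Qed.
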